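(* Let $G$ be a group, $N$ a normal subgroup of $G$ and $H$ a subgroup of $G$ with $N\subseteq H$. Then the lower approximation $\underline{\operatorname{Apr}}_{G/N}(H/N)$ is a normal subgroup of $G/N$.
   Context: Let $G$ be a group (written multiplicatively) and $N$ a normal subgroup of $G$. For $H\subseteq G$ with $N\subseteq H$, $H/N:=\{hN : h\in H\}\subseteq G/N$. The relation $\theta$ on $G/N$ is conjugacy: $xN\,\theta\, yN$ iff $xN=(aya^{-1})N$ for some $a\in G$; the class of $xN$ is $[xN]_\theta=\{(axa^{-1})N : a\in G\}$. For a subset $S\subseteq G/N$, the lower approximation is $\underline{\operatorname{Apr}}_{G/N}(S)=\{xN\in G/N : [xN]_\theta\subseteq S\}$. *)

(* Defs.v *)
From HB Require Import structures.
From mathcomp Require Import all_boot monoid.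
From mathcomp Require Import mathcomp_extra boolp classical_sets.

Set Implicit Arguments.
Unset Strict Implicit.
Unset Printing Implicit Defensive.

Local Open Scope classical_set_scope.
Local Open Scope group_scope.

Definition subgroup (G : groupType) (H : set G) : Prop := group_closed [in H].

Definition normal_subgroup (G : groupType) (N : set G) : Prop :=
  subgroup N /\ forall a x : G, N x -> N (a * x * a^-1).

Definition left_coset (G : groupType) (N : set G) (x : G) : set G :=
  [set x * n | n in N].

(* The proof that N is normal is a parameter of the type of left cosets because
   the group structure below, keyed on [quotient], depends on it. *)
Record quotient (G : groupType) (N : set G) (nN : normal_subgroup N) : Type :=
  Quotient {
    quotient_set :> set G;
    quotient_setP : exists x, quotient_set = left_coset N x
  }.

Section QuotientGroup.
Variables (G : groupType) (N : set G) (nN : normal_subgroup N).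
Local Notation Q := (quotient nN).

HB.instance Definition _ := gen_eqMixin Q.
HB.instance Definition _ := gen_choiceMixin Q.

Lemma quotient_inj (X Y : Q) : X = Y :> set G -> X = Y.
Proof.
case: X Y => [X PX] [Y PY] /= eXY; subst Y.
by congr Quotient; exact: Prop_irrelevance.
Qed.

Definition coset (x : G) : Q := @Quotient G N nN (left_coset N x) (ex_intro _ x erefl).

Lemma coset_surj (X : Q) : exists x, X = coset x.
Proof.
by case: X => X PX; case: (PX) => x Xx; exists x; exact: quotient_inj.
Qed.

Lemma normal1 : N 1.
Proof. by case: nN => -[+ _] _; rewrite inE. Qed.

Lemma normalV x : N x -> N x^-1.
Proof.
by case: nN => nS _ /mem_set Nx; exact/set_mem/(group_closedV nS).
Qed.

Lemma normalM x y : N x -> N y -> N (x * y).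
Proof.
by case: nN => nS _ /mem_set Nx /mem_set Ny; exact/set_mem/(group_closedM nS).
Qed.

Lemma normalJ a x : N x -> N (a * x * a^-1).
Proof. by case: nN => _; exact. Qed.

Lemma coset_eqP x y : coset x = coset y <-> N (x^-1 * y).
Proof.
split=> [/(congr1 (@quotient_set _ _ _))/seteqP[_ /(_ y)] /=|Nxy].
  case; first by exists 1; [exact: normal1 | rewrite mulg1].
  by move=> n Nn <-; rewrite mulKg.
apply/quotient_inj/seteqP; split => _ [n Nn <-] /=.
  exists ((x^-1 * y)^-1 * n); first exact/normalM/Nn/normalV.
  by rewrite invgM invgK !mulgA mulgV mul1g.
exists (x^-1 * y * n); first exact: normalM.
by rewrite !mulgA mulgV mul1g.
Qed.

Lemma quotient_mul_subproof (X Y : Q) :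
  exists x, [set a * b | a in X & b in Y] = left_coset N x.
Proof.
have [[x ->] [y ->]] := (coset_surj X, coset_surj Y); exists (x * y).
apply/seteqP; split => [_ [_ [m Nm <-]] [_ [n Nn <-]] <-|_ [n Nn <-]] /=.
  exists (y^-1 * m * y^-1^-1 * n); first exact/normalM/Nn/normalJ.
  by rewrite invgK !mulgA mulgK.
exists x; first by exists 1; [exact: normal1 | rewrite mulg1].
by exists (y * n); [exists n | rewrite mulgA].
Qed.

Lemma quotient_inv_subproof (X : Q) :
  exists x, [set a^-1 | a in X] = left_coset N x.
Proof.
have [x ->] := coset_surj X; exists x^-1.
apply/seteqP; split => [_ [_ [n Nn <-] <-]|_ [n Nn <-]] /=.
  exists (x * n^-1 * x^-1); first exact/normalJ/normalV.
  by rewrite invgM !mulgA mulVg mul1g.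
exists (n^-1 * x); last by rewrite invgM invgK.
exists (x^-1 * n^-1 * x^-1^-1); first exact/normalJ/normalV.
by rewrite invgK !mulgA mulgV mul1g.
Qed.

Definition quotient_mul (X Y : Q) : Q :=
  @Quotient G N nN _ (quotient_mul_subproof X Y).
Definition quotient_inv (X : Q) : Q :=
  @Quotient G N nN _ (quotient_inv_subproof X).
Definition quotient_one : Q := coset 1.

Lemma quotient_mulE x y : quotient_mul (coset x) (coset y) = coset (x * y).
Proof.
have [z] := coset_surj (quotient_mul (coset x) (coset y)) => e.
rewrite e; apply/coset_eqP.
have : quotient_set (quotient_mul (coset x) (coset y)) (x * y).
  have N1 := normal1.
  by exists x; [exists 1; rewrite ?mulg1 | exists y => //; exists 1; rewrite ?mulg1].
by rewrite e => -[n Nn <-]; rewrite mulKg.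
Qed.

Lemma quotient_invE x : quotient_inv (coset x) = coset x^-1.
Proof.
have [z] := coset_surj (quotient_inv (coset x)) => e.
rewrite e; apply/coset_eqP.
have : quotient_set (quotient_inv (coset x)) x^-1.
  by exists x => //; exists 1; [exact: normal1 | rewrite mulg1].
by rewrite e => -[n Nn <-]; rewrite mulKg.
Qed.

Lemma quotient_mulA : associative quotient_mul.
Proof.
move=> X Y Z.
have [[x ->] [[y ->] [z ->]]] := (coset_surj X, (coset_surj Y, coset_surj Z)).
by rewrite !quotient_mulE mulgA.
Qed.

Lemma quotient_mul1 : left_id quotient_one quotient_mul.
Proof. by move=> X; have [x ->] := coset_surj X; rewrite quotient_mulE mul1g. Qed.

Lemma quotient_mulr1 : right_id quotient_one quotient_mul.
Proof. by move=> X; have [x ->] := coset_surj X; rewrite quotient_mulE mulg1. Qed.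

Lemma quotient_mulV : left_inverse quotient_one quotient_inv quotient_mul.
Proof.
move=> X; have [x ->] := coset_surj X.
by rewrite quotient_invE quotient_mulE mulVg.
Qed.

Lemma quotient_mulrV : right_inverse quotient_one quotient_inv quotient_mul.
Proof.
move=> X; have [x ->] := coset_surj X.
by rewrite quotient_invE quotient_mulE mulgV.
Qed.

HB.instance Definition _ := isGroup.Build Q
  quotient_mulA quotient_mul1 quotient_mulr1 quotient_mulV quotient_mulrV.

Lemma cosetM x y : coset (x * y) = coset x * coset y.
Proof. by rewrite -quotient_mulE. Qed.

Lemma cosetV x : coset x^-1 = (coset x)^-1.
Proof. by rewrite -quotient_invE. Qed.

Lemma coset1 : coset 1 = 1.
Proof. by []. Qed.

Definition image_quotient (H : set G) : set Q := [set coset h | h in H].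

Definition theta (X Y : Q) : Prop :=
  exists x y : G, [/\ X = coset x, Y = coset y
    & exists a : G, coset x = coset (a * y * a^-1)].

Definition theta_class (X : Q) : set Q := [set Y | theta Y X].

Definition lower_apr (S : set Q) : set Q := [set X | theta_class X `<=` S].

Lemma theta_cosetP x y :
  theta (coset x) (coset y) <-> exists a, coset x = coset (a * y * a^-1).
Proof.
split=> [[x' [y' [-> ey [a ->]]]]|[a ea]]; last by exists x, y; split=> //; exists a.
by exists a; rewrite !cosetM -ey.
Qed.

Lemma theta_class_coset x :
  theta_class (coset x) = [set coset (a * x * a^-1) | a in [set: G]].
Proof.
apply/seteqP; split => [Y|_ [a _ <-]] /=; last by apply/theta_cosetP; exists a.
have [y ->] := coset_surj Y.
by move=> /theta_cosetP[a ->]; exists a.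
Qed.

End QuotientGroup.

Arguments coset {G N} nN x.
Arguments image_quotient {G N} nN H.

(* Main.v *)
Require Import Defs.
From mathcomp Require Import all_boot monoid.
From mathcomp Require Import classical_sets.

(** By definition the lower approximation of a set S of cosets consists of the
    X all of whose conjugates lie in S, because conjugating by an element of G
    in the definition of theta is the same as conjugating by an arbitrary
    element of G/N.  When S is a subgroup, this is the normal core of S: the
    intersection of the conjugates of S, the largest normal subgroup of the
    quotient contained in S ([lower_apr_conjP], [normal_lower_apr]).  It remains
    to observe that the image H/N of a subgroup is a subgroup
    ([subgroup_image_quotient]). *)

Local Open Scope classical_set_scope.
Local Open Scope group_scope.

Lemma subgroupP (G : groupType) (H : set G) :
  subgroup H <-> H 1 /\ forall x y, H x -> H y -> H (x * y^-1).
Proof.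
split=> [[H1 HB]|[H1 HB]].
  split=> [|x y Hx Hy]; first exact: set_mem.
  by apply: set_mem; apply: HB; exact: mem_set.
by split=> [|x y /set_mem Hx /set_mem Hy]; apply: mem_set => //; exact: HB.
Qed.

Lemma subgroup_image_quotient (G : groupType) (N : set G)
    (nN : normal_subgroup N) (H : set G) :
  subgroup H -> subgroup (image_quotient nN H).
Proof.
move=> /subgroupP[H1 HB]; apply/subgroupP; split; first by exists 1.
move=> _ _ [x Hx <-] [y Hy <-].
by exists (x * y^-1); [exact: HB | rewrite cosetM cosetV].
Qed.

(** Conjugators range over the group G/N here instead of over
    representatives in G, so that the rest of the argument takes place inside
    the quotient group and no longer mentions cosets. *)
Lemma lower_apr_conjP (G : groupType) (N : set G) (nN : normal_subgroup N)
    (S : set (quotient nN)) (X : quotient nN) :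
  lower_apr S X <-> forall A, S (A * X * A^-1).
Proof.
have [x ->] := coset_surj X; rewrite /lower_apr /= theta_class_coset.
split=> [sXS A|SX _ [a _ <-]]; last by rewrite !cosetM cosetV.
have [a ->] := coset_surj A.
by apply: sXS; exists a; rewrite // !cosetM cosetV.
Qed.

(** Conjugation by a fixed A is an automorphism, so the conjugates of a quotient
    X / Y are quotients of conjugates; and conjugating twice is conjugating by a
    product, which makes the condition on X invariant under conjugation. *)
Lemma normal_lower_apr (G : groupType) (N : set G) (nN : normal_subgroup N)
    (S : set (quotient nN)) :
  subgroup S -> normal_subgroup (lower_apr S).
Proof.
move=> /subgroupP[S1 SB]; split.
  apply/subgroupP; split=> [|X Y /lower_apr_conjP SX /lower_apr_conjP SY].
    by apply/lower_apr_conjP => A; rewrite mulg1 mulgV.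
  apply/lower_apr_conjP => A.
  have -> : A * (X * Y^-1) * A^-1 = A * X * A^-1 * (A * Y * A^-1)^-1.
    by rewrite !invgM invgK !mulgA mulgVK.
  exact: SB.
move=> B X /lower_apr_conjP SX; apply/lower_apr_conjP => A.
have -> : A * (B * X * B^-1) * A^-1 = A * B * X * (A * B)^-1.
  by rewrite invgM !mulgA.
exact: SX.
Qed.

Theorem proposition2p15 (G : groupType) (N : set G) (nN : normal_subgroup N)
    (H : set G) (sH : subgroup H) (sNH : N `<=` H) :
  normal_subgroup (lower_apr (image_quotient nN H)).
Proof. exact/normal_lower_apr/subgroup_image_quotient. Qed.
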